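(* The homogeneous ideal $I(S_{D_{2d}})$ is minimally generated by $\frac{9d^2+2d+8}{8}$ quadrics if $d$ is even and by $\frac{9d^2-4d+3}{8}$ quadrics if $d$ is odd.
   Context: Let $k$ be an algebraically closed field of characteristic zero and $R=k[x_0,x_1,x_2]$ with its standard grading. Fix integers $d\ge 3$ and $0<a<\frac d2$ with $\gcd(a,d)=1$, a primitive $2d$-th root of unity $\varepsilon\in k$, and set $e=\varepsilon^2$. The dihedral group $D_{2d}=\langle \tau,\eta \mid \tau^d=\eta^2=(\eta\tau)^2=1\rangle$ of order $2d$ acts linearly on $R$ with $\tau$ acting as $\mathrm{diag}(1,e^a,e^{d-a})$ and $\eta$ acting as the permutation matrix fixing $x_0$ and interchanging $x_1$ and $x_2$. Let $\Gamma=\langle \mathrm{diag}(1,e,e^{d-1})\rangle\subset\mathrm{GL}(3,k)$, which is the image of $\langle\tau\rangle$, with ring of invariants $R^\Gamma$. Let $\mathcal{B}_{2d}$ be the set consisting of the monomials $x_0^{2d-2i}x_1^ix_2^i$, $0\le i\le d$, and all binomials $x_0^{c_0}x_1^{c_1}x_2^{c_2}+x_0^{c_0}x_1^{c_2}x_2^{c_1}$ with $c_0+c_1+c_2=2d$, $c_1\neq c_2$ and $x_0^{c_0}x_1^{c_1}x_2^{c_2}\in R^{\Gamma}$. Put $\mu_{2d}=|\mathcal{B}_{2d}|$. The elements of $\mathcal{B}_{2d}$ define a morphism $\varphi:\mathbb{P}^2\to\mathbb{P}^{\mu_{2d}-1}$ with image the surface $S_{D_{2d}}=\varphi(\mathbb{P}^2)$.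 Its homogeneous ideal $I(S_{D_{2d}})$ is the kernel of the ring homomorphism $S\to k[\mathcal{B}_{2d}]\subset R$, where $S$ is the standard graded polynomial ring over $k$ with one variable for each element of $\mathcal{B}_{2d}$, sending each variable to the corresponding element of $\mathcal{B}_{2d}$. *)

(* Defs.v *)
From mathcomp Require Import all_boot all_order all_algebra.
From mathcomp Require Import finmap mpoly boolp.

Set Implicit Arguments.
Unset Strict Implicit.
Unset Printing Implicit Defensive.

Import GRing.Theory.
Local Open Scope ring_scope.

(* g . p = p(g x), with x = (x_0, x_1, x_2) as a column vector. *)
Definition linear_subst (k : fieldType) (g : 'M[k]_3) (p : {mpoly k[3]}) :
    {mpoly k[3]} :=
  p \mPo [tuple \sum_(j < 3) g i j *: 'X_j | i < 3].

Definition diag3 (k : fieldType) (u v w : k) : 'M[k]_3 :=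
  diag_mx (\row_(i < 3) [:: u; v; w]`_i).

Definition cyclic_subgroup (k : fieldType) (M g : 'M[k]_3) : Prop :=
  exists n : int, g = M ^ n.

Definition Gamma (k : fieldType) (d : nat) (e : k) : 'M[k]_3 -> Prop :=
  cyclic_subgroup (diag3 1 e (e ^+ (d - 1))).

Definition invariant_ring (k : fieldType) (G : 'M[k]_3 -> Prop)
    (p : {mpoly k[3]}) : Prop :=
  forall g, G g -> linear_subst g p = p.

Definition monom3 (k : fieldType) (c0 c1 c2 : nat) : {mpoly k[3]} :=
  'X_(0 : 'I_3) ^+ c0 * 'X_(1 : 'I_3) ^+ c1 * 'X_(2 : 'I_3) ^+ c2.

Definition dihedral_monomials (k : fieldType) (d : nat) : {fset {mpoly k[3]}} :=
  [fset monom3 k (2 * d - 2 * i)%N i i | i in iota 0 d.+1]%fset.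

(* As a set of polynomials: (c0, c1, c2) and (c0, c2, c1) give one element. *)
Definition dihedral_binomials (k : fieldType) (d : nat) (e : k) :
    {fset {mpoly k[3]}} :=
  [fset (monom3 k (c 0) (c 1) (c 2) + monom3 k (c 0) (c 2) (c 1))%R
     | c : {ffun 'I_3 -> 'I_(2 * d).+1} in
       [pred c : {ffun 'I_3 -> 'I_(2 * d).+1} |
        [&& (\sum_(i < 3) c i == 2 * d)%N, c 1 != c 2 &
            `[< invariant_ring (Gamma d e) (monom3 k (c 0) (c 1) (c 2)) >]]]]%fset.

Definition dihedral_basis (k : fieldType) (d : nat) (e : k) :
    {fset {mpoly k[3]}} :=
  (dihedral_monomials k d `|` dihedral_binomials d e)%fset.

(* The variable 'X_i goes to the i-th element of the duplicate-free list
   underlying B, so that S has one variable for each element of B. *)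
Definition param_morphism (k : fieldType) (B : {fset {mpoly k[3]}})
    (p : {mpoly k[#|` B|]}) : {mpoly k[3]} :=
  p \mPo in_tuple (enum_fset B).

Definition surface_ideal (k : fieldType) (B : {fset {mpoly k[3]}})
    (p : {mpoly k[#|` B|]}) : Prop :=
  param_morphism p = 0.

Definition ideal_generated (A : comNzRingType) (F : {fset A}) (p : A) : Prop :=
  exists c : A -> A, p = \sum_(f <- F) c f * f.

Definition generates (A : comNzRingType) (F : {fset A}) (I : A -> Prop) : Prop :=
  forall p, I p <-> ideal_generated F p.

Definition minimally_generates (A : comNzRingType) (F : {fset A})
    (I : A -> Prop) : Prop :=
  generates F I /\ forall G : {fset A}, (G `<` F)%fset -> ~ generates G I.

Definition minimally_generated_by_quadrics (n : nat) (k : fieldType)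
    (I : {mpoly k[n]} -> Prop) (N : nat) : Prop :=
  exists F : {fset {mpoly k[n]}},
    [/\ #|` F| = N, {in F, forall f, f \is 2.-homog} & minimally_generates F I].

Lemma diag3X (k : fieldType) (u v w : k) (n : nat) :
  diag3 u v w ^+ n = diag3 (u ^+ n) (v ^+ n) (w ^+ n).
Proof.
elim: n => [|n IHn]; rewrite ?exprS ?IHn /diag3.
  by rewrite !expr0 -[1]/(1%:M) -diag_const_mx; congr diag_mx;
     apply/rowP; case=> [[|[|[|]]]] //= Hi; rewrite !mxE.
rewrite -[_ * _]/(_ *m _) mulmx_diag; congr diag_mx.
by apply/rowP; case=> [[|[|[|]]]] //= Hi; rewrite !mxE.
Qed.

(* Gamma is the image of <tau>, for tau acting as diag(1, e^a, e^(d-a)); this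
   is why the surface does not depend on a. *)
Lemma Gamma_rotations (k : fieldType) (d a : nat) (e : k) :
    d.-primitive_root e -> (a <= d)%N -> coprime a d ->
  forall g, Gamma d e g <-> cyclic_subgroup (diag3 1 (e ^+ a) (e ^+ (d - a))) g.
Proof.
move=> prim_e le_ad co_ad.
have d_gt0 := prim_order_gt0 prim_e.
have tauE : diag3 1 (e ^+ a) (e ^+ (d - a)) = diag3 1 e (e ^+ (d - 1)) ^+ a.
  rewrite diag3X expr1n -exprM; congr diag3.
  apply/eqP; rewrite (eq_prim_root_expr prim_e) -(eqn_modDr a) subnK // modnn.
  by rewrite mulnBl mul1n subnK ?modnMr // leq_pmull.
rewrite /Gamma /cyclic_subgroup tauE; set M := diag3 1 e _.
have Md : M ^+ d = 1.
  by rewrite diag3X expr1n exprAC prim_expr_order // expr1n -(expr0 (diag3 1 1 1))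
             diag3X !expr0.
have unitM : M \is a GRing.unit.
  by rewrite -(unitrX_pos _ d_gt0) Md unitr1.
have Mdz (z : int) : M ^ (d%:Z * z) = 1.
  by rewrite -exprz_exp -exprnP Md exp1rz.
move=> g; split=> -[n ->].
  have [u [v uv]] : exists u v : int, a%:Z * u + d%:Z * v = 1.
    have [u [v uv]] := Bezoutz a d; exists u, v.
    by rewrite mulrC [d%:Z * v]mulrC uv /gcdz !absz_nat (eqP co_ad).
  exists (u * n); rewrite exprnP exprz_exp mulrA.
  by rewrite -[n in LHS]mul1r -uv mulrDl exprzDr // -[_ * v * n]mulrA Mdz mulr1.
by exists (a%:Z * n); rewrite exprnP exprz_exp.
Qed.

(* Main.v *)
Require Import Defs.
From HB Require Import structures.
From mathcomp Require Import all_boot all_order all_algebra.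
From mathcomp Require Import finmap ssrcomplements mpoly boolp zify lra.

(** The rotations and the swap generate a group for which
    [z = x_0], [p = x_1 x_2] and [q = x_1^d + x_2^d] are basic invariants, of
    degrees 1, 2 and [d]; they are algebraically independent
    ([basic_invariants_indep]).  In terms of them the elements of the basis are
    the monomials [z^a p^b q^c] with [a + 2 b + d c = 2 d], except that
    [x_1^{2d} + x_2^{2d}] is [q^2 - 2 p^d] ([dihedral_gen], [mem_dihedral_basis]).
    So, up to a linear change of one variable, the surface is the toric surface
    whose lattice points are the [(b, c)] of the triangle [2 b + d c <= 2 d], and
    its ideal is a toric ideal.

    That the toric ideal is generated by quadrics is a statement about multisets
    of lattice points: two multisets of the same size and the same sum can be
    joined by moves that replace two points by two points with the same sum
    ([fibers_linked]).  The induction peels off a point that depends only on the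
    size and on the sum: the apex [(0, 2)] if the sum of the ordinates is at
    least 2, and otherwise the point [(min(B, d), 0)] of the base, where [B] is
    the sum of the abscissae.  Modulo the quadrics, a polynomial of
    the kernel then reduces to a combination of elements whose images are
    pairwise distinct monomials, and such a combination vanishes
    ([toric_kernel]).

    Quadrics that form a basis of the degree 2 part of the ideal are a minimal
    set of generators, and their number is the dimension of that part
    ([minimal_quadrics]).  In [n] variables it equals [C(n + 1, 2)] minus the
    dimension of the image in degree [4 d], which is the number of lattice
    points of the doubled triangle [2 b + d c <= 4 d], since each of these is a
    sum of two points of the triangle ([split_point]).  Both numbers of points
    are read off the rows of the triangles ([quadric_count]). *)

Set Implicit Arguments.
Unset Strict Implicit.
Unset Printing Implicit Defensive.

Import Order.TTheory GRing.Theory.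
Local Open Scope ring_scope.

(** * Minimal generation by quadrics *)

Lemma ideal_generatedD (A : comNzRingType) (F : {fset A}) (p q : A) :
  ideal_generated F p -> ideal_generated F q -> ideal_generated F (p + q).
Proof.
move=> [c ->] [c' ->]; exists (fun f => c f + c' f).
by rewrite -big_split; apply: eq_bigr => f _; rewrite mulrDl.
Qed.

Lemma ideal_generatedM (A : comNzRingType) (F : {fset A}) (a p : A) :
  ideal_generated F p -> ideal_generated F (a * p).
Proof.
move=> [c ->]; exists (fun f => a * c f).
by rewrite mulr_sumr; apply: eq_bigr => f _; rewrite mulrA.
Qed.

Lemma ideal_generated_mem (A : comNzRingType) (F : {fset A}) (f : A) :
  f \in F -> ideal_generated F f.
Proof.
move=> Ff; exists (fun g => (g == f)%:R).
rewrite (bigD1_seq f) ?fset_uniq //= eqxx mul1r big1 ?addr0 // => g /negPf ->.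
by rewrite mul0r.
Qed.

(** This turns a polynomial relation between forms of the same degree into a
    linear one. *)
Lemma pihomogM_low (k : fieldType) n d (c g : {mpoly k[n]}) :
  g \is d.-homog -> pihomog mdeg d (c * g) = c@_0%MM *: g.
Proof.
move=> hg.
have piX m : pihomog mdeg d ('X_[m] * g) = (m == 0%MM)%:R *: g.
  have hXg : 'X_[m] * g \is (mdeg m + d).-homog.
    by apply: dhomogM => //; rewrite dhomogX.
  have [->|m0] := eqVneq; first by rewrite mpolyX0 mul1r pihomog_dE // scale1r.
  by rewrite scale0r (pihomog_ne0 _ hXg) // -[X in _ != X]add0n eqn_add2r mdeg_eq0.
rewrite [in LHS](mpolyE c) mulr_suml linear_sum /=.
rewrite (eq_bigr (fun m => (c@_m * (m == 0%MM)%:R) *: g)); last first.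
  by move=> m _; rewrite -scalerAl linearZ /= piX scalerA.
rewrite -scaler_suml; congr (_ *: _).
have [c0|c0] := boolP (0%MM \in msupp c).
  rewrite (bigD1_seq 0%MM) ?msupp_uniq //= eqxx mulr1 big1 ?addr0 // => m /negPf->.
  by rewrite mulr0.
rewrite (memN_msupp_eq0 c0) big_seq big1 // => m cm.
by case: eqVneq cm => [->|]; rewrite ?(negPf c0) ?mulr0.
Qed.

(** A basis of the space of quadrics in the kernel works: every quadric of the
    kernel is a linear combination of its elements, and by [pihomogM_low] none
    of them lies in the ideal generated by the others.  The rank theorem for
    the restriction of [phi] to quadrics gives the size of the basis, because
    the monomials with exponents in [K] form a basis of the image.  The last
    hypothesis says, without choosing generators, that the quadrics of the
    kernel generate it. *)
Lemma minimal_quadrics (k : fieldType) n m (phi : {linear {mpoly k[n]} -> {mpoly k[m]}})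
    (K : seq 'X_{1..m}) :
    (0 < n)%N -> uniq K ->
    (forall p, p \is 2.-homog -> {subset msupp (phi p) <= K}) ->
    (forall kappa, kappa \in K -> exists2 p, p \is 2.-homog & phi p = 'X_[kappa]) ->
    (forall p q, phi q = 0 -> phi (p * q) = 0) ->
    (forall J : {mpoly k[n]} -> Prop,
       (forall p q, J p -> J q -> J (p + q)) -> (forall p q, J q -> J (p * q)) ->
       (forall p, p \is 2.-homog -> phi p = 0 -> J p) ->
     forall p, phi p = 0 -> J p) ->
  minimally_generated_by_quadrics (fun p => phi p = 0) ('C(n.+1, 2) - size K).
Proof.
case: n phi => // n phi _ uniqK suppK surjK idealK genK.
pose V := dhomog n.+1 k 2; pose r := size K.
(* Only the coefficients at [K] matter, so they are coordinates of the image. *)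
pose f (v : V) : 'rV[k]_r := \row_i (phi (val v))@_(nth 0%MM K i).
have f_lin : linear f.
  by move=> a u v; apply/rowP=> i; rewrite !mxE linearP mcoeffD mcoeffZ.
pose fL : {linear V -> 'rV[k]_r} := HB.pack f (GRing.isLinear.Build _ _ _ _ f f_lin).
pose U := lker (linfun fL).
have memU v : v \in U <-> phi (val v) = 0.
  rewrite memv_ker lfunE /= /f; split=> [/eqP/rowP v0 | v0]; last first.
    by apply/eqP/rowP=> i; rewrite !mxE v0 mcoeff0.
  apply/mpolyP=> mu; rewrite mcoeff0; apply/eqP; rewrite mcoeff_eq0.
  apply/negP=> v_mu; have /(nthP 0%MM)[i lt_i mu_i] := suppK _ (valP v) _ v_mu.
  have := v0 (Ordinal lt_i); rewrite !mxE /= mu_i => /eqP.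
  by rewrite mcoeff_eq0 v_mu.
have imL : limg (linfun fL) = fullv.
  apply/eqP; rewrite eqEsubv subvf /=; apply/subvP=> w _.
  have /fin_all_exists[p phi_p] : forall i : 'I_r,
      exists p : V, phi (val p) = 'X_[nth 0%MM K i].
    by move=> i; have [p hp <-] := surjK _ (mem_nth 0%MM (ltn_ord i)); exists (DHomog hp).
  have -> : w = linfun fL (\sum_i w 0 i *: p i); last exact: memv_img (memvf _).
  rewrite lfunE; apply/rowP=> j; rewrite !mxE.
  rewrite !linear_sum /= (bigD1 j) //= !linearZ /= phi_p mcoeffX eqxx mulr1.
  rewrite big1 ?addr0 // => i ij; rewrite !linearZ /= phi_p mcoeffX.
  by rewrite nth_uniq // [i == j :> nat](negPf ij) mulr0.
have dimU : \dim U = ('C(n.+2, 2) - r)%N.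
  have := limg_ker_dim (linfun fL) fullv; rewrite imL capfv !dimvf -/U => e.
  have : (\dim U + r = 'C(2 + n, 2))%N by move: e; rewrite /dim /= mul1n.
  by rewrite add2n => <-; rewrite addnK.
pose b := vbasis U.
have /andP[/eqP spanb freeb] := vbasisP U.
pose s := [seq val v | v <- b].
have uniqs : uniq s by rewrite map_inj_uniq ?(free_uniq freeb) //; exact: val_inj.
pose F := [fset p in s]%fset.
have permF : perm_eq F s.
  by apply: uniq_perm; rewrite ?fset_uniq // => p; rewrite !inE.
exists F; split.
- by rewrite (perm_size permF) size_map size_tuple.
- by move=> p; rewrite !inE => /mapP[v _ ->]; apply: valP.
have FI p : p \in F -> phi p = 0.
  by rewrite !inE => /mapP[v bv ->]; apply/memU/vbasis_mem.
have genF : generates F (fun p => phi p = 0).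
  move=> p; split=> [|[c ->]]; last first.
    rewrite linear_sum big_seq big1 //= => q qF.
    by apply: idealK; apply: FI.
  apply: genK => [p1 p2|p1 p2|{}p hp phi_p].
  - exact: ideal_generatedD.
  - exact: ideal_generatedM.
  have /coord_vbasis def_p : DHomog hp \in U by apply/memU.
  rewrite -[p]/(val (DHomog hp)) def_p linear_sum /=.
  apply: (big_ind (ideal_generated F)) => [||i _].
  - exists (fun=> 0); rewrite big1 // => q _; exact: mul0r.
  - exact: ideal_generatedD.
  rewrite -mul_mpolyC; apply/ideal_generatedM/ideal_generated_mem.
  by rewrite !inE map_f // mem_nth ?size_tuple.
split=> // G; rewrite fproperE => /andP[subGF /fsubsetPn[p Fp notGp]] genG.
have /genG[c def_p] := FI _ Fp.
have hp : p \is 2.-homog by move: Fp; rewrite !inE => /mapP[v _ ->]; apply: valP.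
have permG : perm_eq G [seq q <- s | q \in G].
  apply: uniq_perm; rewrite ?fset_uniq ?filter_uniq // => q.
  rewrite mem_filter andb_idr // => Gq.
  by rewrite -(perm_mem permF); apply: (fsubsetP subGF).
have {}def_p : p = \sum_(q <- s | q \in G) (c q)@_0%MM *: q.
  rewrite -big_filter -(perm_big _ permG) -(pihomog_dE hp) [in LHS]def_p linear_sum /=.
  rewrite big_seq [RHS]big_seq; apply: eq_bigr => q Gq; apply: pihomogM_low.
  by have := fsubsetP subGF _ Gq; rewrite !inE => /mapP[v _ ->]; apply: valP.
have /(nthP p)[i0] : p \in s by rewrite -(perm_mem permF).
rewrite size_map size_tuple => lt_i0; pose i := Ordinal lt_i0.
rewrite (nth_map (0 : V)) ?size_tuple // => p_i.
(* If [G] generates without the basis vector [p], the degree 2 part of an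
   expression of [p] by [G] is a linear relation between basis vectors in which
   [p] has coefficient -1. *)
pose mu (j : 'I_(\dim U)) : k :=
  (if val b`_j \in G then (c (val b`_j))@_0%MM else 0) - (j == i)%:R.
have /(freeP freeb)/(_ i) : \sum_j mu j *: b`_j = 0.
  apply: val_inj; rewrite /= linear_sum /=.
  rewrite (eq_bigr (fun j : 'I_(\dim U) =>
    (if val b`_j \in G then (c (val b`_j))@_0%MM *: val b`_j else 0)
      - (j == i)%:R *: val b`_j)); last first.
    by move=> j _; rewrite [LHS]linearZ /mu /= scalerBl; case: ifP => // _; rewrite scale0r.
  rewrite big_split sumrN /= -big_mkcond /= [X in _ - X](bigD1 i) //= eqxx scale1r.
  rewrite [X in _ - (_ + X)]big1 ?addr0; last by move=> j /negPf->; rewrite scale0r.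
  rewrite p_i [in X in _ - X]def_p big_map (big_nth 0) size_tuple big_mkord.
  exact: subrr.
rewrite /mu eqxx /= p_i (negPf notGp) sub0r => /eqP.
by rewrite oppr_eq0 oner_eq0.
Qed.

(** * Quadratic moves between multisets of lattice points *)

(** The point [(b, c)] stands for the monomial [z^(w - 2b - dc) p^b q^c] of
    weighted degree [w]. *)
Definition triangle (d w : nat) : pred (nat * nat) :=
  fun x => (2 * x.1 + d * x.2 <= w)%N.

Notation abscissa s := (\sum_(x <- s) x.1)%N.
Notation ordinate s := (\sum_(x <- s) x.2)%N.

(** The equivalence of multisets, listed in any order, generated by quadratic
    moves inside the triangle. *)
Inductive linked (d : nat) : seq (nat * nat) -> seq (nat * nat) -> Prop :=
| linked_perm s s' : perm_eq s s' -> linked d s s'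
| linked_move x y x' y' s :
    triangle d (2 * d) x -> triangle d (2 * d) y ->
    triangle d (2 * d) x' -> triangle d (2 * d) y' ->
    (x.1 + y.1 = x'.1 + y'.1)%N -> (x.2 + y.2 = x'.2 + y'.2)%N ->
    linked d [:: x, y & s] [:: x', y' & s]
| linked_trans s s' s'' : linked d s s' -> linked d s' s'' -> linked d s s''.

Lemma linked_refl d s : linked d s s.
Proof. exact/linked_perm/perm_refl. Qed.

(** A move requires the old and the new points to lie in the triangle, so that
    it can be undone. *)
Lemma linked_sym d s s' : linked d s s' -> linked d s' s.
Proof.
elim=> {s s'} [s s' ss' | x y x' y' s Tx Ty Tx' Ty' e1 e2 | s s' s'' _ IH _ IH'].
- by apply: linked_perm; rewrite perm_sym.
- exact: linked_move.
- exact: linked_trans IH' IH.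
Qed.

Lemma linked_cons d z s s' : linked d s s' -> linked d (z :: s) (z :: s').
Proof.
elim=> {s s'} [s s' ss' | x y x' y' s Tx Ty Tx' Ty' e1 e2 | s s' s'' _ IH _ IH'].
- by apply: linked_perm; rewrite perm_cons.
- have rot u v : perm_eq [:: z, u, v & s] [:: u, v, z & s].
    by apply/permP=> f /=; lia.
  apply: linked_trans (linked_perm _ (rot x y)) _.
  by apply: linked_trans (linked_move _ Tx Ty Tx' Ty' e1 e2) _;
     apply: linked_perm; rewrite perm_sym.
- exact: linked_trans IH IH'.
Qed.

Lemma linked_invariants d s s' : linked d s s' ->
  [/\ size s = size s', abscissa s = abscissa s', ordinate s = ordinate s' &
      all (triangle d (2 * d)) s = all (triangle d (2 * d)) s'].
Proof.
elim=> {s s'} [s s' ss' | x y x' y' s Tx Ty Tx' Ty' e1 e2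
              | s s' s'' _ [-> -> -> ->] _ //].
- by rewrite (perm_size ss') !(perm_big _ ss') (perm_all _ ss').
- by rewrite /= !big_cons Tx Ty Tx' Ty'; split=> //; lia.
Qed.

Lemma positive_ordinate (s : seq (nat * nat)) : (0 < ordinate s)%N ->
  exists (x : nat * nat) (s' : seq (nat * nat)), perm_eq s (x :: s') /\ (0 < x.2)%N.
Proof.
rewrite lt0n sum_nat_seq_neq0 => /hasP[x xs /= x2].
by exists x, (rem x s); rewrite perm_to_rem // lt0n.
Qed.

(** A point of ordinate 2 is the apex [(0, 2)]; otherwise there are two points
    of ordinate 1, and [(b, 1)], [(b', 1)] move to [(0, 2)], [(b + b', 0)]. *)
Lemma extract_apex d s : (0 < d)%N ->
    all (triangle d (2 * d)) s -> (2 <= ordinate s)%N ->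
  exists s', linked d s ((0, 2) :: s').
Proof.
move=> d_gt0 Ts s2.
have apex x : triangle d (2 * d) x -> (1 < x.2)%N -> x = (0%N, 2).
  case: x => b c; rewrite /triangle /= => Tx c2.
  have c_le2 : (c <= 2)%N by rewrite -(leq_pmul2l d_gt0); lia.
  have ec : c = 2 by lia.
  by move: Tx; rewrite ec => Tx; congr pair; lia.
have [x [s1 [sx x2]]] := positive_ordinate (ltnW s2).
have: all (triangle d (2 * d)) (x :: s1) by rewrite -(perm_all _ sx).
case/andP=> Tx Ts1; have := s2; rewrite (perm_big _ sx) big_cons /= => {}s2.
case: (ltnP 1 x.2) => [/(apex x Tx) x02 | x_le1].
  by exists s1; apply: linked_perm; rewrite -x02.
have /positive_ordinate[y [s3 [s1y y2]]] : (0 < ordinate s1)%N by lia.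
have sxy : perm_eq s [:: x, y & s3].
  by apply: perm_trans sx _; rewrite perm_cons.
have: all (triangle d (2 * d)) (y :: s3) by rewrite -(perm_all _ s1y).
case/andP=> Ty Ts3.
case: (ltnP 1 y.2) => [/(apex y Ty) y02 | y_le1].
  exists (x :: s3); apply: linked_perm; rewrite -y02.
  by apply: perm_trans sxy _; apply/permP=> a /=; lia.
exists ((x.1 + y.1, 0)%N :: s3).
apply: linked_trans (linked_perm _ sxy) _.
by apply: linked_move => //; move: Tx Ty; rewrite /triangle /=; nia.
Qed.

(** The points hand over their abscissae, one after the other, to a point of
    the base until it reaches the corner [(d, 0)] or nothing is left. *)
Lemma extract_base d s : (0 < d)%N -> (1 < size s)%N ->
    all (triangle d (2 * d)) s -> (ordinate s <= 1)%N ->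
  exists s', linked d s ((minn (abscissa s) d, 0) :: s').
Proof.
move=> d_gt0.
have step x r r' m : triangle d (2 * d) x -> (x.2 <= 1)%N ->
    abscissa r = m -> linked d r ((minn m d, 0) :: r') ->
    exists r'', linked d (x :: r) ((minn (x.1 + m) d, 0) :: r'')%N.
  move=> Tx x2 <- rr'; set m0 := minn _ _ in rr' *.
  exists ((x.1 + m0 - minn (x.1 + abscissa r) d, x.2)%N :: r').
  apply: linked_trans (linked_cons x rr') _.
  by apply: linked_move; move: Tx; rewrite /triangle /m0 /=; nia.
(* With at most one point of ordinate 1, any two points of [s] contain one of
   the base, so the recursion stops at lists of length 2. *)
elim: s => [//|x s IHs]; rewrite !big_cons /= ltnS => s_gt0 /andP[Tx Ts] s2.
have x2 : (x.2 <= 1)%N by lia.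
case: s s_gt0 IHs Ts s2 => [//|y [_ _ /andP[Ty _]|z s _ IHs Ts s2]]; last first.
  have [//|//||s' s's] := IHs; first by lia.
  exact: step s's.
rewrite !big_seq1 => s2.
have [y2|y2] := posnP y.2.
  apply: (step x [:: y] [::] y.1) => //; rewrite ?big_seq1 //.
  suff <- : y = (minn y.1 d, 0)%N by apply: linked_refl.
  by move: y Ty {s2} y2 => [b c]; rewrite /triangle /= => Tb ->; congr pair; nia.
exists [:: (x.1 + y.1 - minn (x.1 + y.1) d, 1)%N].
by apply: linked_move => //; move: Tx Ty; rewrite /triangle /=; nia.
Qed.

(** By [extract_apex] and [extract_base] both multisets are linked to multisets
    that share a point; remove it and conclude by induction on the size. *)
Theorem fibers_linked d s s' : (0 < d)%N ->
    all (triangle d (2 * d)) s -> all (triangle d (2 * d)) s' ->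
    size s = size s' -> abscissa s = abscissa s' -> ordinate s = ordinate s' ->
  linked d s s'.
Proof.
move=> d_gt0; elim: {s}(size s) {-2}s s' (erefl (size s)) => [|n IHn] s s'.
  by case: s s' => [|//] [|//] _ _ _ _ _ _; apply: linked_refl.
move=> size_s Ts Ts' size_s' e1 e2.
have [n_gt0|/eqP n0] := ltnP 0 n; last first.
  case: s s' n0 size_s size_s' e1 e2 {Ts Ts' IHn} => [|[a b] []] //.
  - by move=> [|[a' b'] []] //; rewrite !big_seq1 /= => _ _ _ -> ->; apply: linked_refl.
  - by case: n => // ? ? ? ?.
suff [x [r [r' [sr s'r']]]] : exists x r r', linked d s (x :: r) /\ linked d s' (x :: r').
  have := linked_invariants sr; have := linked_invariants s'r'; rewrite /= !big_cons => -[].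
  rewrite Ts' => z' a' o' /esym/andP[_ Tr'] [z a o]; rewrite Ts => /esym/andP[_ Tr].
  apply: linked_trans sr (linked_trans _ (linked_sym s'r')).
  by apply/linked_cons/IHn => //; lia.
have [s2|s2] := leqP 2 (ordinate s).
  have [r sr] := extract_apex d_gt0 Ts s2.
  rewrite e2 in s2; have [r' sr'] := extract_apex d_gt0 Ts' s2.
  by exists (0%N, 2), r, r'.
have [||r sr] := extract_base d_gt0 _ Ts _; [lia | lia |].
have [||r' sr'] := extract_base d_gt0 _ Ts' _; [lia | lia |].
by rewrite -e1 in sr'; exists (minn (abscissa s) d, 0)%N, r, r'.
Qed.

(** * Algebraic independence of the basic invariants *)

(** Distinct monomials in the [t_i] have distinct leading monomials, hence the
    largest of these occurs exactly once in [p(t)] and cannot cancel. *)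
Lemma comp_mpoly_inj_mlead (k : fieldType) n m (t : n.-tuple {mpoly k[m]}) :
    (forall i, tnth t i != 0) ->
    injective (fun mu : 'X_{1..n} => (\sum_(i < n) mlead (tnth t i) *+ mu i)%MM) ->
  forall p : {mpoly k[n]}, p \mPo t = 0 -> p = 0.
Proof.
move=> t_neq0 lead_inj p; apply: contra_eq => p_neq0.
pose term mu := p@_mu *: ('X_[mu] \mPo t).
have monom_neq0 (mu : 'X_{1..n}) : 'X_[mu] \mPo t != 0.
  by rewrite comp_mpolyX prodf_seq_neq0; apply/allP=> i _; rewrite expf_neq0.
have lead_term mu : mu \in msupp p ->
    mlead (term mu) = (\sum_(i < n) mlead (tnth t i) *+ mu i)%MM.
  rewrite mcoeff_msupp => p_mu; rewrite mleadZ // comp_mpolyX mlead_prod.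
    by apply: eq_bigr => i _; rewrite mleadX.
  by move=> i _ _; rewrite expf_neq0.
pose L mu := mlead (term mu).
have [mu0 p_mu0 /eqP max_mu0] :
    {mu0 | mu0 \in msupp p & (\join_(mu <- msupp p) L mu == L mu0)%O}.
  by apply: eq_bigjoin; rewrite ?msupp_eq0 //; apply: le_total.
suff: (p \mPo t)@_(L mu0) != 0 by apply: contra_neq => ->; rewrite mcoeff0.
rewrite comp_mpolyEX raddf_sum /= (bigD1_seq mu0) ?msupp_uniq //= big_seq_cond.
rewrite big1 ?addr0 => [|mu /andP[p_mu mu_neq]].
  by rewrite mleadc_eq0 scaler_eq0 negb_or monom_neq0 -mcoeff_msupp p_mu0.
apply: mcoeff_gt_mlead; rewrite -/(term mu) -/(L mu) lt_neqAle -max_mu0.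
rewrite joins_sup_seq // andbT max_mu0; apply: contra_neq mu_neq.
by rewrite /L !lead_term // => /lead_inj.
Qed.

Lemma mpolyX_neq0 (k : fieldType) n (m : 'X_{1..n}) : 'X_[m] != 0 :> {mpoly k[n]}.
Proof. by rewrite -msupp_eq0 msuppX. Qed.

Definition mnm3 (a b c : nat) : 'X_{1..3} := [multinom nth 0%N [:: a; b; c] i | i < 3].

Lemma mnm3P (m : 'X_{1..3}) a b c :
  m = mnm3 a b c <-> [/\ m (0 : 'I_3) = a, m (1 : 'I_3) = b & m (2 : 'I_3) = c].
Proof.
split=> [->|[m0 m1 m2]]; first by rewrite !mnmE.
by apply/mnmP=> -[[|[|[]]] // lt_i]; rewrite mnmE /= -?m0 -?m1 -?m2; congr (m _); apply: val_inj.
Qed.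

Lemma monom3E (k : fieldType) a b c : monom3 k a b c = 'X_[mnm3 a b c].
Proof.
by rewrite mpolyXE_id !big_ord_recl big_ord0 mulr1 !mnmE /monom3 mulrA.
Qed.

Definition basic_invariants (k : fieldType) (d : nat) : 3.-tuple {mpoly k[3]} :=
  [tuple 'X_(0 : 'I_3); 'X_(1 : 'I_3) * 'X_(2 : 'I_3);
         'X_(1 : 'I_3) ^+ d + 'X_(2 : 'I_3) ^+ d].

Lemma mlead_power_sum (k : fieldType) d : (0 < d)%N ->
  mlead ('X_(1 : 'I_3) ^+ d + 'X_(2 : 'I_3) ^+ d : {mpoly k[3]}) = (U_(1%R) *+ d)%MM.
Proof.
move=> d_gt0.
rewrite mleadDl ?mpolyXn ?mleadXm //.
apply/ltmcP.
  by rewrite !mdegMn !mdeg1.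
exists (1 : 'I_3); last by rewrite !mulmnE !mnm1E eqxx mul1n mul0n.
by case=> [[|[]]] //= ? _; rewrite !mulmnE !mnm1E.
Qed.

(** The leading exponents are [(1, 0, 0)], [(0, 1, 1)] and [(0, d, 0)], which are
    linearly independent. *)
Lemma basic_invariants_indep (k : fieldType) d (p : {mpoly k[3]}) : (0 < d)%N ->
  p \mPo basic_invariants k d = 0 -> p = 0.
Proof.
move=> d_gt0; apply: comp_mpoly_inj_mlead.
  case=> [[|[|[]]]] //= ?; rewrite (tnth_nth 0) /=.
  - exact: mpolyX_neq0.
  - by rewrite mulf_neq0 // mpolyX_neq0.
  - rewrite -mleadc_eq0 mlead_power_sum // !mpolyXn mcoeffD !mcoeffX eqxx.
    suff /negPf-> : (U_(2%R) *+ d)%MM != (U_(1%R) *+ d)%MM :> 'X_{1..3} by rewrite addr0 oner_eq0.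
    apply/eqP=> /mnmP/(_ 1); rewrite !mulmnE !mnm1E mul0n mul1n => d0.
    by rewrite -d0 in d_gt0.
move=> mu mu' /=.
rewrite !big_ord_recl !big_ord0 !(tnth_nth 0) /= !addm0.
rewrite mlead_power_sum // mleadM ?mpolyX_neq0 // !mleadXm.
move=> /mnmP e; have := e 0; have := e 1; have := e 2.
rewrite !mnmDE !mulmnE !mnmDE !mnm1E /=.
rewrite !mul1n !mul0n !addn0 !add0n => e2 e1 e0.
rewrite e2 in e1; move/addnI/eqP: e1; rewrite eqn_pmul2l // => /eqP e1.
apply/mnmP=> -[[|[|[]]] // lt_i].
- by move: e0; congr (mu _ = mu' _); apply: val_inj.
- by move: e2; congr (mu _ = mu' _); apply: val_inj.
- by move: e1; congr (mu _ = mu' _); apply: val_inj.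
Qed.

(** * Lattice points and weighted degree *)

Definition lattice (d w : nat) : seq (nat * nat) :=
  [seq (b, c) | c <- iota 0 (w %/ d).+1, b <- iota 0 ((w - d * c)./2).+1]%N.
(* Row 0 is never empty, so simplification would unfold its first point. *)
Arguments lattice : simpl never.

Lemma mem_lattice d w x : (0 < d)%N -> (x \in lattice d w) = triangle d w x.
Proof.
move=> d_gt0; case: x => b c; rewrite /triangle /=.
apply/allpairsPdep/idP => [[c' [b' []]]|tx].
  rewrite !mem_iota !add0n !ltnS /= leq_divRL // => cw bw [-> ->]; lia.
by exists c, b; split=> //; rewrite mem_iota add0n ltnS ?leq_divRL //=; lia.
Qed.

Lemma lattice_uniq d w : uniq (lattice d w).
Proof.
apply: allpairs_uniq_dep => [|c _|[c b] [c' b'] _ _ /= [-> ->]] //; exact: iota_uniq.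
Qed.

Lemma size_lattice d w :
  size (lattice d w) = (\sum_(0 <= c < (w %/ d).+1) ((w - d * c)./2).+1)%N.
Proof.
rewrite size_allpairs_dep sumnE big_map; apply: eq_bigr => c _.
by rewrite size_iota.
Qed.

(** The degrees of [z], [p] and [q] are 1, 2 and [d]. *)
Definition wdeg (d : nat) (m : 'X_{1..3}) : nat :=
  (m 0%R + 2 * m 1%R + d * m 2%R)%N.

Lemma wdeg0 d : wdeg d 0%MM = 0%N.
Proof. by rewrite /wdeg !mnm0E !muln0. Qed.

Lemma wdegD d : {morph wdeg d : m1 m2 / (m1 + m2)%MM >-> (m1 + m2)%N}.
Proof. by move=> m1 m2; rewrite /wdeg !mnmDE; lia. Qed.

HB.instance Definition _ d := isMeasure.Build 3 (wdeg d) (wdeg0 d) (wdegD d).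

Lemma dhomog_comp (k : fieldType) n m (mf : measure m) D e (t : n.-tuple {mpoly k[m]}) p :
  (forall i, tnth t i \is D.-homog for mf) -> p \is e.-homog ->
  p \mPo t \is (D * e)%N.-homog for mf.
Proof.
move=> ht hp; rewrite comp_mpolyEX big_seq rpred_sum // => mu p_mu.
have <- : mdeg mu = e := dhomog_mf hp p_mu.
apply: dhomogZ; rewrite comp_mpolyX mdegE big_distrr /=.
apply: (big_rec2 (fun p d => p \is d.-homog for mf)); first exact: dhomog1.
by move=> i q d' _ hq; apply: dhomogM => //; apply: dhomogMn.
Qed.

(** The exponent of [z] is determined by the weighted degree [w]; subtraction is
    truncated, so this is meaningful only in the triangle. *)
Definition expo (d w : nat) (x : nat * nat) : 'X_{1..3} :=
  mnm3 (w - 2 * x.1 - d * x.2) x.1 x.2.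

Lemma expo_inj d w : injective (expo d w).
Proof.
move=> [b c] [b' c'] /mnmP e; congr pair; first by have := e 1; rewrite !mnmE.
by have := e 2; rewrite !mnmE.
Qed.

Lemma wdeg_expo d w x : triangle d w x -> wdeg d (expo d w x) = w.
Proof. by rewrite /triangle /wdeg !mnmE /=; lia. Qed.

Lemma wdegP d w m : wdeg d m = w -> exists2 x, triangle d w x & m = expo d w x.
Proof.
move=> wm; exists (m 1, m 2); move: wm; rewrite /triangle /wdeg /=; first lia.
by move=> wm; apply/mnm3P; split=> //=; lia.
Qed.

Lemma expoD d w w' x y : triangle d w x -> triangle d w' y ->
  (expo d w x + expo d w' y)%MM = expo d (w + w') (x.1 + y.1, x.2 + y.2)%N.
Proof.
rewrite /triangle => tx ty.
by apply/mnm3P; split; rewrite !mnmE //=; lia.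
Qed.

(** * The toric ideal *)

(** An element of the basis as a polynomial in [z], [p] and [q].  The apex
    [(0, 2)] stands for [x_1^{2d} + x_2^{2d} = q^2 - 2 p^d] rather than for
    [q^2], which explains the correction by the corner [(d, 0)]. *)
Definition toric_gen (k : fieldType) (d : nat) (x : nat * nat) : {mpoly k[3]} :=
  'X_[expo d (2 * d) x] -
  (if x.2 == 2 then 2%:R *: 'X_[expo d (2 * d) (d, 0%N)] else 0).

Definition toric_gens (k : fieldType) (d n : nat) (pts : n.-tuple (nat * nat)) :
    n.-tuple {mpoly k[3]} :=
  [tuple toric_gen k d (tnth pts i) | i < n].

(** A sum with one term when the points are distinct and [x] is one of them; this
    form needs no default index. *)
Definition point_var (k : fieldType) (n : nat) (pts : n.-tuple (nat * nat)) (x : nat * nat) :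
    {mpoly k[n]} :=
  \sum_(i < n | tnth pts i == x) 'X_i.

(** The linear change of variables that undoes the correction in [toric_gen]:
    the new coordinates go to monomials ([phi_toric_coord]). *)
Definition toric_coord (k : fieldType) (d n : nat) (pts : n.-tuple (nat * nat))
    (x : nat * nat) : {mpoly k[n]} :=
  point_var k pts x + (if x.2 == 2 then 2%:R *: point_var k pts (d, 0%N) else 0).

Lemma point_var_tnth (k : fieldType) n (pts : n.-tuple (nat * nat)) i :
  uniq pts -> point_var k pts (tnth pts i) = 'X_i.
Proof.
move=> /tuple_uniqP pts_inj; rewrite /point_var (big_pred1 i) // => j /=.
by rewrite (inj_eq pts_inj).
Qed.

Section ToricKernel.

Variables (k : fieldType) (d n : nat) (pts : n.-tuple (nat * nat)).
Hypotheses (d_gt0 : (0 < d)%N) (pts_uniq : uniq pts).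
Hypothesis mem_pts : forall x, (x \in pts) = triangle d (2 * d) x.

Local Notation phi := (comp_mpoly (toric_gens k d pts)).
Local Notation Y := (toric_coord k d pts).
Local Notation base := (d, 0%N).

Lemma triangle_base : triangle d (2 * d) base.
Proof. by rewrite /triangle /=; lia. Qed.

Lemma point_var_homog x : triangle d (2 * d) x -> point_var k pts x \is 1.-homog.
Proof.
by rewrite -mem_pts => /tnthP[i ->]; rewrite point_var_tnth // dhomogX; apply/eqP/mdeg1.
Qed.

Lemma phi_point_var x : triangle d (2 * d) x -> phi (point_var k pts x) = toric_gen k d x.
Proof.
rewrite -mem_pts => /tnthP[i ->]; rewrite point_var_tnth //.
by rewrite comp_mpolyXU -tnth_nth tnth_mktuple.
Qed.

Lemma toric_coord_homog x : triangle d (2 * d) x -> Y x \is 1.-homog.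
Proof.
move=> tx; rewrite rpredD ?point_var_homog //.
by case: ifP => _; rewrite ?rpred0 // dhomogZ // point_var_homog // triangle_base.
Qed.

Lemma phi_toric_coord x : triangle d (2 * d) x -> phi (Y x) = 'X_[expo d (2 * d) x].
Proof.
move=> tx; rewrite /toric_coord raddfD /= phi_point_var // {1}/toric_gen.
case: (x.2 == 2); last by rewrite subr0 raddf0 addr0.
by rewrite comp_mpolyZ phi_point_var ?triangle_base // /toric_gen /= subr0 subrK.
Qed.

Lemma variable_toric_coord i :
  'X_i = Y (tnth pts i) - (if (tnth pts i).2 == 2 then 2%:R *: Y base else 0).
Proof.
rewrite /toric_coord /= addr0 point_var_tnth //.
by case: ifP => _; rewrite ?addr0 ?subr0 // addrK.
Qed.

Notation Ymon s := (\prod_(x <- s) Y x).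
Notation allT s := (all (triangle d (2 * d)) s).

(** The exponents of a product of coordinates remember the sum of the points
    and, through the weighted degree, their number. *)
Lemma sum_expo s : allT s ->
  triangle d (2 * d * size s) (abscissa s, ordinate s) /\
  (\sum_(x <- s) expo d (2 * d) x)%MM = expo d (2 * d * size s) (abscissa s, ordinate s).
Proof.
elim: s => [_|x s IHs] /=.
  by rewrite !big_nil /triangle /=; split; [lia | apply/mnm3P; rewrite !mnm0E /=; split; lia].
case/andP=> tx /IHs[ts e]; rewrite !big_cons e.
rewrite expoD // mulnS; split=> //.
by move: tx ts; rewrite /triangle /=; lia.
Qed.

Lemma same_expo_linked s s' : allT s -> allT s' ->
  (\sum_(x <- s) expo d (2 * d) x)%MM = (\sum_(x <- s') expo d (2 * d) x)%MM ->
  linked d s s'.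
Proof.
move=> Ts Ts'; have [t e] := sum_expo Ts; have [t' e'] := sum_expo Ts'.
rewrite e e' => E; have := wdeg_expo t'; rewrite -E wdeg_expo // => /eqP.
rewrite eqn_pmul2l ?muln_gt0 // => /eqP es.
move: E; rewrite es => /expo_inj[ea eo].
exact: fibers_linked.
Qed.

Lemma phi_Ymon s : allT s -> phi (Ymon s) = 'X_[\sum_(x <- s) expo d (2 * d) x].
Proof.
move=> Ts; rewrite rmorph_prod /= -mprodXE big_seq [RHS]big_seq.
by apply: eq_bigr => x xs; rewrite phi_toric_coord // (allP Ts).
Qed.

Definition monomial_comb (l : seq (k * seq (nat * nat))) : {mpoly k[n]} :=
  \sum_(u <- l) u.1 *: Ymon u.2.
Definition on_triangle (l : seq (k * seq (nat * nat))) := all (fun u => allT u.2) l.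

(** The coordinates and the variables determine each other linearly
    ([variable_toric_coord]), so products of coordinates span. *)
Lemma toric_span f : exists2 l, on_triangle l & f = monomial_comb l.
Proof.
pose Q f := exists2 l, on_triangle l & f = monomial_comb l.
have QD p q : Q p -> Q q -> Q (p + q).
  move=> [l Tl ->] [l' Tl' ->]; exists (l ++ l'); last by rewrite /monomial_comb big_cat.
  by rewrite /on_triangle all_cat; apply/andP.
have QM p q : Q p -> Q q -> Q (p * q).
  move=> [l Tl ->] [l' Tl' ->].
  exists [seq (u.1 * v.1, u.2 ++ v.2) | u <- l, v <- l'].
    apply/allP=> w /allpairsP[[u v] [/= ul vl ->]] /=.
    by rewrite all_cat (allP Tl _ ul) (allP Tl' _ vl).
  rewrite /monomial_comb big_allpairs_dep /= mulr_suml; apply: eq_bigr => u _.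
  rewrite mulr_sumr; apply: eq_bigr => v _.
  by rewrite big_cat /= -scalerAl -scalerAr scalerA.
have QC c : Q c%:MP.
  by exists [:: (c, [::])]; rewrite // /monomial_comb big_seq1 big_nil -mul_mpolyC mulr1.
have QY x : triangle d (2 * d) x -> Q (Y x).
  move=> tx; exists [:: (1, [:: x])]; first by rewrite /on_triangle /= tx.
  by rewrite /monomial_comb !big_seq1 scale1r.
have QX i : Q 'X_i.
  rewrite variable_toric_coord; apply: QD; first by apply: QY; rewrite -mem_pts mem_tnth.
  case: ifP => _; last by rewrite oppr0 -mpolyC0; apply: QC.
  by rewrite -scaleNr -mul_mpolyC; apply: QM; [apply: QC | apply: QY triangle_base].
elim/mpolyind: f => [|c m p _ _ Qp]; first by rewrite -mpolyC0; apply: QC.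
apply: QD Qp; rewrite -mul_mpolyC; apply: (QM); first exact: QC.
rewrite mpolyXE_id; apply: (big_ind Q) => [||i _]; [by rewrite -mpolyC1; apply: QC | exact: QM |].
elim: (m i) => [|e IHe]; first by rewrite expr0 -mpolyC1; apply: QC.
by rewrite exprS; apply: QM.
Qed.

Section QuadricIdeal.

Variable J : {mpoly k[n]} -> Prop.
Hypothesis JD : forall p q, J p -> J q -> J (p + q).
Hypothesis JM : forall p q, J q -> J (p * q).
Hypothesis Jquad : forall p, p \is 2.-homog -> phi p = 0 -> J p.

Lemma ideal0 : J 0.
Proof. by apply: Jquad; rewrite ?rpred0 // raddf0. Qed.

(** Each move multiplies a binomial quadric of the kernel by a monomial. *)
Lemma linked_congr s s' : linked d s s' -> J (Ymon s - Ymon s').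
Proof.
elim=> {s s'} [s s' ss' | x y x' y' s Tx Ty Tx' Ty' e1 e2 | s s' s'' _ J1 _ J2].
- by rewrite (perm_big _ ss') subrr; apply: ideal0.
- rewrite !big_cons !mulrA -mulrBl mulrC; apply/JM/Jquad.
    by rewrite rpredB // -[2%N]/(1 + 1)%N dhomogM ?toric_coord_homog.
  rewrite raddfB /= !rmorphM /= !phi_toric_coord // -!mpolyXD !expoD // e1 e2.
  exact: subrr.
- by rewrite -(subrK (Ymon s') (Ymon s)) -addrA; apply: JD.
Qed.

(** Group the terms of [p] by the exponent of their image.  Terms in one group
    are congruent modulo [J] by [fibers_linked], and their coefficients add up
    to 0 because distinct groups have distinct images. *)
Lemma toric_kernel p : phi p = 0 -> J p.
Proof.
have [l Tl ->] := toric_span p; rewrite /monomial_comb.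
elim: {l}(size l).+1 {-2}l (ltnSn (size l)) Tl => // N IHN [|[c s] l].
  by rewrite big_nil => _ _ _; apply: ideal0.
move: {l}(_ :: l) (mem_head (c, s) l) => L cs_L le_L TL.
pose E (u : k * seq (nat * nat)) := (\sum_(x <- u.2) expo d (2 * d) x)%MM.
have Ts : allT s := allP TL _ cs_L.
pose S P := \sum_(u <- [seq u <- L | P u]) u.1 *: Ymon u.2.
have phi_sum P : phi (S P) = \sum_(u <- [seq u <- L | P u]) u.1 *: 'X_[E u].
  rewrite linear_sum big_seq [RHS]big_seq; apply: eq_bigr => u.
  by rewrite mem_filter => /andP[_ uL]; rewrite linearZ /= phi_Ymon // (allP TL).
pose same := fun u => E u == E (c, s).
have -> : \sum_(u <- L) u.1 *: Ymon u.2 = S same + S (predC same).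
  by rewrite /S !big_filter (bigID same).
move=> phi0; pose C := \sum_(u <- [seq u <- L | same u]) u.1.
have C0 : C = 0.
  have := congr1 (mcoeff (E (c, s))) phi0.
  rewrite raddfD /= !phi_sum mcoeffD mcoeff0 !raddf_sum /= [X in _ + X]big_seq.
  rewrite [X in _ + X]big1 ?addr0 => [<-|u].
    rewrite /C big_seq [RHS]big_seq; apply: eq_bigr => u.
    by rewrite mem_filter => /andP[/eqP uE _]; rewrite mcoeffZ mcoeffX uE eqxx mulr1.
  by rewrite mem_filter mcoeffZ mcoeffX => /andP[/negPf uE _]; rewrite [_ == _]uE mulr0.
apply: JD.
  have -> : S same = \sum_(u <- [seq u <- L | same u]) u.1 *: (Ymon u.2 - Ymon s).
    under [RHS]eq_bigr do rewrite scalerBr.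
    by rewrite sumrB -scaler_suml -/C C0 scale0r subr0.
  rewrite big_seq; apply: (big_ind J) => [||u]; [exact: ideal0 | exact: JD |].
  rewrite mem_filter -mul_mpolyC => /andP[/eqP uE uL]; apply/JM/linked_congr.
  by apply: same_expo_linked; rewrite // (allP TL).
apply: IHN.
- rewrite ltnS in le_L; apply: leq_trans le_L.
  rewrite size_filter -(count_predC same L) -[X in (X <= _)%N]add1n leq_add2r.
  by rewrite -has_count; apply/hasP; exists (c, s); rewrite // /same.
- by rewrite /on_triangle all_filter; apply/allP=> u uL; apply/implyP=> _; apply: (allP TL).
have phi_same : phi (S same) = 0.
  rewrite phi_sum big_seq (eq_bigr (fun u => u.1 *: 'X_[E (c, s)])) => [|u].
    by rewrite -scaler_suml -big_seq -/C C0 scale0r.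
  by rewrite mem_filter => /andP[/eqP-> _].
by move: phi0; rewrite raddfD /= phi_same add0r.
Qed.

End QuadricIdeal.

(** The triangle of weight [4 d] is twice that of weight [2 d], and every lattice
    point of it is a sum of two: subtract the apex if the ordinate allows it, and
    otherwise as much of the base as possible. *)
Lemma split_point x : triangle d (4 * d) x -> exists y z,
  [/\ triangle d (2 * d) y, triangle d (2 * d) z & x = (y.1 + z.1, y.2 + z.2)%N].
Proof.
case: x => b c; rewrite /triangle /= => tx.
have c_le4 : (c <= 4)%N by rewrite -(leq_pmul2l d_gt0); lia.
have [c_ge2|c_lt2] := leqP 2 c.
  exists (0, 2)%N, (b, c - 2)%N; split=> /=; [by lia | by nia | congr pair; lia].
exists (minn b d, 0)%N, (b - minn b d, c)%N; split=> /=; [by lia | by nia | congr pair; lia].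
Qed.

(** Linear coordinates do not change degrees, and the image of the quadrics is
    spanned by the monomials of weighted degree [4 d]. *)
Theorem toric_quadrics :
  minimally_generated_by_quadrics (fun p => phi p = 0)
    ('C(n.+1, 2) - size (lattice d (4 * d))).
Proof.
rewrite -(size_map (expo d (4 * d))); apply: minimal_quadrics => [|||||].
- have := mem_pts base; rewrite triangle_base => /tnthP[i _].
  exact: leq_ltn_trans (ltn_ord i).
- by rewrite map_inj_uniq ?lattice_uniq //; exact: expo_inj.
- move=> p hp m p_m.
  have toric_gen_homog i : tnth (toric_gens k d pts) i
      \is (2 * d)%N.-homog for (wdeg d).
    rewrite tnth_mktuple rpredB //.
      by rewrite dhomogX; apply/eqP/wdeg_expo; rewrite -mem_pts mem_tnth.
    by case: ifP => _; rewrite ?rpred0 // dhomogZ // dhomogX; apply/eqP/wdeg_expo/triangle_base.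
  have /wdegP[x tx ->] := dhomog_mf (dhomog_comp toric_gen_homog hp) p_m.
  by rewrite mulnAC in tx *; apply: map_f; rewrite mem_lattice.
- move=> _ /mapP[x + ->]; rewrite mem_lattice // => /split_point[y [z [ty tz ->]]].
  exists (Y y * Y z); first by rewrite -[2%N]/(1 + 1)%N dhomogM ?toric_coord_homog.
  by rewrite rmorphM /= !phi_toric_coord // -mpolyXD expoD // -mulnDl.
- by move=> p q phi_q; rewrite rmorphM /= phi_q mulr0.
- exact: toric_kernel.
Qed.

End ToricKernel.

(** * The dihedral basis *)

Lemma comp_mpoly_comp (k : fieldType) n m r (t : n.-tuple {mpoly k[m]})
    (u : m.-tuple {mpoly k[r]}) p :
  (p \mPo t) \mPo u = p \mPo [tuple tnth t i \mPo u | i < n].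
Proof.
rewrite [p \mPo t]comp_mpolyEX [RHS]comp_mpolyEX linear_sum; apply: eq_bigr => m0 _.
rewrite linearZ /= !comp_mpolyX rmorph_prod /=; congr (_ *: _).
by apply: eq_bigr => i _; rewrite rmorphXn tnth_mktuple.
Qed.

Definition dihedral_gen (k : fieldType) (d : nat) (x : nat * nat) : {mpoly k[3]} :=
  toric_gen k d x \mPo basic_invariants k d.

Lemma comp_basic_invariants (k : fieldType) d a b c :
  'X_[mnm3 a b c] \mPo basic_invariants k d =
  monom3 k a b b * ('X_(1 : 'I_3) ^+ d + 'X_(2 : 'I_3) ^+ d) ^+ c.
Proof.
rewrite comp_mpolyX !big_ord_recl big_ord0 mulr1 !mnmE !(tnth_nth 0) /=.
by rewrite exprMn /monom3 !mulrA.
Qed.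

Lemma monom3M (k : fieldType) a b c a' b' c' :
  monom3 k a b c * monom3 k a' b' c' = monom3 k (a + a') (b + b') (c + c').
Proof.
by rewrite !monom3E -mpolyXD; congr 'X_[_]; apply/mnm3P; rewrite !mnmDE !mnmE.
Qed.

Lemma dihedral_gen_monomial (k : fieldType) d b :
  dihedral_gen k d (b, 0%N) = monom3 k (2 * d - 2 * b) b b.
Proof.
by rewrite /dihedral_gen /toric_gen /= subr0 comp_basic_invariants expr0 mulr1 muln0 subn0.
Qed.

Lemma power_sum_monom3 (k : fieldType) d :
  'X_(1 : 'I_3) ^+ d + 'X_(2 : 'I_3) ^+ d = monom3 k 0 d 0 + monom3 k 0 0 d.
Proof. by rewrite /monom3 !expr0 !mulr1 !mul1r. Qed.

(** The ordinate is 1 or 2.  For 2 the point is the apex and the middle term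
    [2 p^d] of [q^2] cancels the correction in [toric_gen]. *)
Lemma dihedral_gen_binomial (k : fieldType) d x :
  (0 < d)%N -> triangle d (2 * d) x -> (0 < x.2)%N ->
  let c0 := (2 * d - 2 * x.1 - d * x.2)%N in
  dihedral_gen k d x = monom3 k c0 (x.1 + d * x.2) x.1 + monom3 k c0 x.1 (x.1 + d * x.2).
Proof.
case: x => b c; rewrite /triangle /= => d_gt0 tx c_gt0.
have : (c <= 2)%N by rewrite -(leq_pmul2l d_gt0); lia.
rewrite leq_eqVlt ltnS => /orP[/eqP c2|c1].
  have b0 : b = 0%N by move: tx; rewrite c2; lia.
  rewrite /dihedral_gen /toric_gen c2 b0 /= raddfB /= comp_mpolyZ !comp_basic_invariants.
  rewrite power_sum_monom3 expr0 mulr1 expr2 mulrDl !mulrDr !monom3M !muln0 !subn0 !addn0 !add0n.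
  rewrite [(d * 2)%N]mulnC /= !subnn addnn -mul2n scaler_nat mulr2n.
  by rewrite (addrC (monom3 k 0 d d) (monom3 k 0 0 _)) addrACA addrK.
have {c1 c_gt0} -> : c = 1%N by lia.
rewrite /dihedral_gen /toric_gen /= subr0 comp_basic_invariants expr1.
rewrite power_sum_monom3 mulrDr !monom3M.
by rewrite !addn0 muln1.
Qed.

(** The monomial of a point occurs with coefficient 1 in its own generator.  It
    occurs in another one only if the point is the corner [(d, 0)] and the other
    one has ordinate 2, and this relation is not symmetric. *)
Lemma toric_gen_inj (k : fieldType) d : injective (toric_gen k d).
Proof.
have coef x y : x != y -> (toric_gen k d y)@_(expo d (2 * d) x) =
    - (if (y.2 == 2) && (x == (d, 0%N)) then 2%:R else 0).
  move=> /negPf xy; rewrite /toric_gen mcoeffB mcoeffX.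
  rewrite (inj_eq (@expo_inj d (2 * d))) eq_sym xy sub0r.
  case: (y.2 == 2) => /=; last by rewrite mcoeff0.
  rewrite mcoeffZ mcoeffX (inj_eq (@expo_inj d (2 * d))) eq_sym.
  by case: eqP => _; rewrite ?mulr1 ?mulr0.
have coef1 x : (toric_gen k d x)@_(expo d (2 * d) x) = 1.
  rewrite /toric_gen mcoeffB mcoeffX eqxx; case: ifP => [/eqP x2|_]; last by rewrite mcoeff0 subr0.
  rewrite mcoeffZ mcoeffX (inj_eq (@expo_inj d (2 * d))).
  case: eqP => [x0|_]; last by rewrite mulr0 subr0.
  by rewrite -x0 in x2.
move=> x y e; apply/eqP; apply: contraT => xy.
have := coef1 x; rewrite e coef //; case: ifP => [/andP[/eqP y2 /eqP x0] _|_ /eqP]; last first.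
  by rewrite oppr0 eq_sym oner_eq0.
have := coef1 y; rewrite -e coef 1?eq_sym // x0 /= oppr0 => /eqP.
by rewrite eq_sym oner_eq0.
Qed.

Lemma dihedral_gen_inj (k : fieldType) d : (0 < d)%N -> injective (dihedral_gen k d).
Proof.
move=> d_gt0 x y /eqP; rewrite -subr_eq0 /dihedral_gen -raddfB /= => /eqP.
move=> /(basic_invariants_indep d_gt0) /eqP; rewrite subr_eq0 => /eqP.
exact: toric_gen_inj.
Qed.

Lemma linear_subst_diag (k : fieldType) (u v w : k) a b c :
  linear_subst (diag3 u v w) (monom3 k a b c) = (u ^+ a * v ^+ b * w ^+ c) *: monom3 k a b c.
Proof.
have diagE (i : 'I_3) :
    \sum_(j < 3) diag3 u v w i j *: 'X_j = [:: u; v; w]`_i *: 'X_i :> {mpoly k[3]}.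
  rewrite (bigD1 i) //= !mxE eqxx mulr1n big1 ?addr0 // => j.
  by rewrite !mxE eq_sym => /negPf->; rewrite mulr0n scale0r.
rewrite /linear_subst monom3E comp_mpolyX !big_ord_recl big_ord0 mulr1 !tnth_mktuple.
rewrite !diagE !mnmE /= -monom3E /monom3 !exprZn.
by rewrite -!scalerAl -!scalerAr !scalerA !mulrA; congr (_ *: _); rewrite mulrAC.
Qed.

(** The generator multiplies the monomial by [e^(c1 + (d - 1) c2)]. *)
Lemma invariant_monom3 (k : fieldType) d (e : k) c0 c1 c2 : d.-primitive_root e ->
  invariant_ring (Gamma d e) (monom3 k c0 c1 c2) <-> (d %| c1 + (d - 1) * c2)%N.
Proof.
move=> prim_e; have d_gt0 := prim_order_gt0 prim_e.
set M := diag3 1 e (e ^+ (d - 1)).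
have substM n : linear_subst (M ^+ n) (monom3 k c0 c1 c2) =
    (e ^+ (c1 + (d - 1) * c2)) ^+ n *: monom3 k c0 c1 c2.
  rewrite diag3X linear_subst_diag !expr1n mul1r -!exprM -exprD.
  by congr ((_ ^+ _) *: _); lia.
split=> [inv|dvd_d].
  have := inv M; rewrite -[M in linear_subst M]expr1 substM expr1.
  move=> /(_ (ex_intro _ 1%:Z erefl))/(congr1 (mcoeff (mnm3 c0 c1 c2))).
  by rewrite mcoeffZ monom3E mcoeffX eqxx mulr1 (prim_order_dvd prim_e) => ->.
have inv n : linear_subst (M ^+ n) (monom3 k c0 c1 c2) = monom3 k c0 c1 c2.
  by rewrite substM; move: dvd_d; rewrite (prim_order_dvd prim_e) => /eqP->; rewrite expr1n scale1r.
have Md : M ^+ d = 1.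
  by rewrite diag3X expr1n exprAC prim_expr_order // expr1n -(expr0 (diag3 1 1 1))
             diag3X !expr0.
have unitM : M \is a GRing.unit by rewrite -(unitrX_pos _ d_gt0) Md unitr1.
move=> g [[n|n] ->]; first exact: inv.
rewrite NegzE -exprnN.
(* [M ^+ d] is 1, so every negative power is also a natural one. *)
have -> : (M ^+ n.+1)^-1 = M ^+ (n.+1 * (d - 1)).
  apply: (mulrI (unitrX n.+1 unitM)); rewrite mulrV ?unitrX // -exprD -mulnS.
  by rewrite subn1 prednK // mulnC exprM Md expr1n.
exact: inv.
Qed.

(** A binomial of the basis has [c1] and [c2] congruent modulo [d] and distinct;
    it comes from the lattice point made of the smaller of them and of their
    difference divided by [d]. *)
Lemma mem_dihedral_basis (k : fieldType) d (e : k) : d.-primitive_root e ->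
  forall p : {mpoly k[3]},
  (p \in dihedral_basis d e) = (p \in [seq dihedral_gen k d x | x <- lattice d (2 * d)]).
Proof.
move=> prim_e; have d_gt0 := prim_order_gt0 prim_e.
have inv c0 c1 c2 := invariant_monom3 c0 c1 c2 prim_e.
move=> p; rewrite in_fsetU; apply/orP/idP => [[]|/mapP[[b c]]].
- case/imfsetP=> i lt_i ->; apply/mapP.
  have {}lt_i : (i <= d)%N by move: lt_i; rewrite mem_iota.
  by exists (i, 0%N); rewrite ?dihedral_gen_monomial // mem_lattice // /triangle /=; lia.
- case/imfsetP=> c /and3P[/eqP sum_c c12 /asboolP/inv dvd_c] ->; apply/mapP.
  move: sum_c c12 dvd_c; rewrite !big_ord_recl big_ord0 addn0.
  rewrite -val_eqE /=.
  have -> : c (lift ord0 ord0) = c 1 by congr (c _); apply: val_inj.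
  have -> : c (lift ord0 (lift ord0 ord0)) = c 2 by congr (c _); apply: val_inj.
  have -> : c ord0 = c 0 by congr (c _); apply: val_inj.
  move: (nat_of_ord (c 0)) (nat_of_ord (c 1)) (nat_of_ord (c 2)) => c0 c1 c2.
  wlog lt21 : c1 c2 / (c2 < c1)%N => [IH sum_c c12 dvd_c|sum_c _ dvd_c].
    case: (ltngtP c2 c1) (c12) => // [lt21|lt12] _; first exact: IH.
    rewrite addrC; apply: IH => //; [by rewrite (addnC c2) | by rewrite eq_sym |].
    have e1 : (c2 + (d - 1) * c1 = d * c1 + (c2 - c1))%N by nia.
    have e2 : (c1 + (d - 1) * c2 + (c2 - c1) = d * c2)%N by nia.
    have : (d %| c1 + (d - 1) * c2 + (c2 - c1))%N by rewrite e2 dvdn_mulr.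
    by rewrite dvdn_addr // e1 dvdn_addr ?dvdn_mulr.
  have e1 : (c1 + (d - 1) * c2 = d * c2 + (c1 - c2))%N by nia.
  move: dvd_c; rewrite e1 dvdn_addr ?dvdn_mulr // => /dvdnP[j ej].
  have j_gt0 : (0 < j)%N by case: j ej => //; lia.
  have def_c1 : c1 = (c2 + d * j)%N by lia.
  have tx : triangle d (2 * d) (c2, j) by rewrite /triangle /=; lia.
  exists (c2, j); first by rewrite mem_lattice.
  by rewrite dihedral_gen_binomial //= -def_c1; congr (monom3 _ _ _ _ + monom3 _ _ _ _); lia.
rewrite mem_lattice // => tx ->.
have [->|c_gt0] := posnP c.
  left; rewrite dihedral_gen_monomial; apply/imfsetP; exists b => //.
  suff : b \in iota 0 d.+1 by [].
  by rewrite mem_iota; move: tx; rewrite /triangle /=; lia.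
right; rewrite dihedral_gen_binomial //=.
move: tx; rewrite /triangle /= => tx.
set a := (2 * d - 2 * b - d * c)%N; set b' := (b + d * c)%N.
pose f : {ffun 'I_3 -> 'I_(2 * d).+1} := [ffun i : 'I_3 => inord (nth 0%N [:: a; b'; b] i)].
have f0 : f 0 = a :> nat by rewrite ffunE inordK //= /a; lia.
have f1 : f 1 = b' :> nat by rewrite ffunE inordK //= /b'; lia.
have f2 : f 2 = b :> nat by rewrite ffunE inordK //=; lia.
apply/imfsetP; exists f; last by rewrite f0 f1 f2.
apply/and3P; split.
- rewrite !big_ord_recl big_ord0 addn0.
  have -> : f (lift ord0 ord0) = f 1 by congr (f _); apply: val_inj.
  have -> : f (lift ord0 (lift ord0 ord0)) = f 2 by congr (f _); apply: val_inj.
  have -> : f ord0 = f 0 by congr (f _); apply: val_inj.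
  by rewrite f0 f1 f2 /a /b'; lia.
- rewrite -val_eqE /= f1 f2 /b' -[X in _ != X]addn0 eqn_add2l.
  by rewrite -lt0n muln_gt0 d_gt0.
- apply/asboolP/inv; rewrite f1 f2 /b'.
  have -> : (b + d * c + (d - 1) * b = d * (b + c))%N by nia.
  exact: dvdn_mulr.
Qed.

(** The variables are numbered by an unspecified enumeration of the basis; this
    carries it over to the lattice points. *)
Lemma enum_dihedral_basis (k : fieldType) d (e : k) : d.-primitive_root e ->
  exists2 s, perm_eq s (lattice d (2 * d)) &
    enum_fset (dihedral_basis d e) = [seq dihedral_gen k d x | x <- s].
Proof.
move=> prim_e; have d_gt0 := prim_order_gt0 prim_e.
pose L := lattice d (2 * d).
have : perm_eq (dihedral_basis d e) [seq dihedral_gen k d x | x <- L].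
  apply: uniq_perm; [exact: fset_uniq | | exact: mem_dihedral_basis].
  by rewrite map_inj_uniq ?lattice_uniq //; exact: dihedral_gen_inj.
case/(perm_iotaP 0)=> Is; rewrite size_map => perm_Is ->.
exists [seq nth (0, 0)%N L i | i <- Is].
  by rewrite -[X in perm_eq _ X](mkseq_nth (0, 0)%N); apply: perm_map.
rewrite -map_comp; apply/eq_in_map=> i; rewrite (perm_mem perm_Is) mem_iota => /andP[_ lt_i].
by rewrite (nth_map (0, 0)%N).
Qed.

Lemma eq_minimally_generated n (k : fieldType) (I I' : {mpoly k[n]} -> Prop) N :
  (forall p, I p <-> I' p) ->
  minimally_generated_by_quadrics I N -> minimally_generated_by_quadrics I' N.
Proof.
move=> II' [F [cardF homF [genF minF]]]; exists F; split=> //; split.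
  by move=> p; rewrite -II'; apply: genF.
by move=> G GF genG; apply: (minF G GF) => p; rewrite II'; apply: genG.
Qed.

(** The map to the polynomial ring is the toric one followed by the injective
    substitution of the basic invariants, so both have the same kernel. *)
Theorem dihedral_quadrics (k : fieldType) d (e : k) : d.-primitive_root e ->
  minimally_generated_by_quadrics (@surface_ideal k (dihedral_basis d e))
    ('C((size (lattice d (2 * d))).+1, 2) - size (lattice d (4 * d))).
Proof.
move=> prim_e; have d_gt0 := prim_order_gt0 prim_e.
have [s perm_s enum_s] := enum_dihedral_basis prim_e.
have size_s : size s == #|` dihedral_basis d e| by rewrite enum_s size_map.
pose pts := Tuple size_s.
rewrite -(perm_size perm_s) (eqP size_s).
apply: (@eq_minimally_generated _ _ (fun p => p \mPo toric_gens k d pts = 0)); last first.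
  apply: toric_quadrics => // [|x]; first by rewrite (perm_uniq perm_s) lattice_uniq.
  by rewrite -(mem_lattice _ _ d_gt0); apply: perm_mem.
move=> p; rewrite /surface_ideal /param_morphism.
have -> : in_tuple (enum_fset (dihedral_basis d e)) =
    [tuple tnth (toric_gens k d pts) i \mPo basic_invariants k d | i < #|` dihedral_basis d e|].
  apply: val_inj; rewrite [LHS]enum_s -[s]/(tval pts) -[in LHS](map_tnth_enum pts) -map_comp.
  by apply: eq_map => i; rewrite /= tnth_mktuple.
rewrite -comp_mpoly_comp; split=> [->|]; first exact: raddf0.
exact: basic_invariants_indep.
Qed.

(** * Counting lattice points *)

Lemma size_lattice_mul d w : (0 < d)%N ->
  size (lattice d (w * d)) = (\sum_(c < w.+1) (((w - c) * d)./2).+1)%N.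
Proof.
move=> d_gt0; rewrite size_lattice mulnK // big_mkord; apply: eq_bigr => c _.
by rewrite mulnBl [(d * c)%N]mulnC.
Qed.

Lemma size_lattice2 d : (0 < d)%N -> size (lattice d (2 * d)) = (d + d./2 + 3)%N.
Proof.
by move=> d_gt0; rewrite size_lattice_mul // !big_ord_recl big_ord0 /= /bump /=; lia.
Qed.

Lemma size_lattice4 d : (0 < d)%N ->
  size (lattice d (4 * d)) = (3 * d + (3 * d)./2 + d./2 + 5)%N.
Proof.
by move=> d_gt0; rewrite size_lattice_mul // !big_ord_recl big_ord0 /= /bump /=; lia.
Qed.

(** The two counts multiplied by 8, with the term [- 4 d] of the odd case moved to
    the left so that it is not truncated. *)
Lemma quadric_count d : (3 <= d)%N ->
  let N := ('C((size (lattice d (2 * d))).+1, 2) - size (lattice d (4 * d)))%N in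
  (8 * N + (if odd d then 4 * d else 0) = 9 * d ^ 2 + (if odd d then 3 else 2 * d + 8))%N.
Proof.
move=> d_ge3 N; rewrite /N {N} size_lattice2 ?size_lattice4; try lia.
set n := (d + d./2 + 3)%N.
have bin2n : (2 * 'C(n.+1, 2) = n.+1 * n)%N.
  by rewrite bin2 -[in RHS](odd_double_half (n.+1 * n)) oddM /= andNb add0n -mul2n.
set m := d./2; have := odd_double_half d; rewrite -/m -mul2n.
case: (odd d) => /= def_d.
  have {}def_d : (d = 2 * m + 1)%N by lia.
  have def_n : (n = 3 * m + 4)%N by rewrite /n -/m; lia.
  have half3 : ((3 * d)./2 = 3 * m + 1)%N by lia.
  by rewrite half3; move: bin2n; rewrite def_n; set C := 'C(_, _); nia.
have {}def_d : (d = 2 * m)%N by lia.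
have def_n : (n = 3 * m + 3)%N by rewrite /n -/m; lia.
have half3 : ((3 * d)./2 = 3 * m)%N by lia.
by rewrite half3; move: bin2n; rewrite def_n; set C := 'C(_, _); nia.
Qed.

Theorem corollary4p7 (k : closedFieldType) (hchar : [pchar k] =i pred0)
    (d a : nat) (hd : (3 <= d)%N) (ha0 : (0 < a)%N) (had : (2 * a < d)%N)
    (hco : coprime a d) (eps : k) (heps : (2 * d).-primitive_root eps) :
  let e := eps ^+ 2 in
  let I := @surface_ideal k (dihedral_basis d e) in
  (~~ odd d ->
     exists2 N : nat,
       N%:R = (9 * d%:R ^+ 2 + 2 * d%:R + 8) / 8 :> rat &
       minimally_generated_by_quadrics I N) /\
  (odd d ->
     exists2 N : nat,
       N%:R = (9 * d%:R ^+ 2 - 4 * d%:R + 3) / 8 :> rat &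
       minimally_generated_by_quadrics I N).
Proof.
move=> e I.
have prim_e : d.-primitive_root e.
  have := exp_prim_root heps 2.
  by rewrite gcdnC (gcdn_idPr _) ?dvdn_mulr // mulKn.
have count := quadric_count hd; have minI := dihedral_quadrics prim_e.
set N := (_ - _)%N in count minI.
split=> odd_d; exists N => //; move: count; rewrite /= ?odd_d ?(negPf odd_d).
  rewrite addn0 => /(congr1 (fun n => n%:R : rat)).
  by rewrite !natrD !natrM => e8; lra.
move=> /(congr1 (fun n => n%:R : rat)).
by rewrite !natrD !natrM => e8; lra.
Qed.
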